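(* Let $T$ be a tree, let $\mu$ be a positive function on $T$, and let $\varphi : T \to T$ be a self-map of $T$. Put $\sigma_\varphi = \sup_{v \in T} \frac{\mu(v)}{\mu(\varphi(v))}$. Then the composition operator $C_\varphi$ is bounded on $L_\mu^\infty$ if and only if $\sigma_\varphi$ is finite. Furthermore, $\|C_\varphi\| = \sigma_\varphi$ (operator norm on $L_\mu^\infty$).
   Context: A tree $T$ is a locally finite, connected, simply-connected graph, identified as a set with its set of vertices; it is assumed to have no terminal vertices (a vertex is terminal if it has a unique neighbor), hence to be infinite, and it is rooted at a vertex $o$. A function on $T$ is a complex-valued function on the set of vertices. For a positive function $\mu: T \to (0,\infty)$ (the weight), $L_\mu^\infty$ is the Banach space of all functions $f$ on $T$ with $\|f\|_\mu = \sup_{v \in T} \mu(v)|f(v)| < \infty$. For an arbitrary self-map $\varphi$ of (the vertex set of) $T$, the composition operator is $C_\varphi f = f \circ \varphi$. Saying that $C_\varphi$ is bounded on $L_\mu^\infty$ means that it maps $L_\mu^\infty$ into itself as a bounded linear operator. *)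

(* Defs.v *)
From HB Require Import structures.
From mathcomp Require Import all_boot all_order all_algebra.
From mathcomp Require Import all_classical all_reals all_analysis.
From mathcomp Require Import complex.

Set Implicit Arguments.
Unset Strict Implicit.
Unset Printing Implicit Defensive.

Import Order.TTheory GRing.Theory Num.Theory.
Import numFieldNormedType.Exports.

Local Open Scope classical_set_scope.
Local Open Scope ring_scope.

(* Trees without terminal vertices, identified with their sets of vertices.
   Simple connectedness of a graph is the absence of simple cycles; a [ucycle]
   of size 2 only goes back and forth along an edge. The one-vertex graph
   has no terminal vertex either, and is ruled out by [tree_infinite]. *)
Record tree := Tree {
  vertex :> choiceType ;
  adj : rel vertex ;
  tree_root : vertex ;
  adj_sym : symmetric adj ;
  adj_irr : irreflexive adj ;
  tree_locally_finite : forall v, finite_set [set w | adj v w] ;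
  tree_connected : forall v w, exists2 p, path adj v p & last v p = w ;
  tree_acyclic : forall c, ucycle adj c -> (size c <= 2)%N ;
  tree_no_terminal : forall v, ~ exists! w, adj v w ;
  tree_infinite : infinite_set [set: vertex]
}.

Section weighted_Linf.
Context {R : realType} {T : tree} (mu : T -> {posnum R}).
Implicit Types f g : T -> R[i].

Definition wnorm f : \bar R :=
  ereal_sup (range (fun v => ((mu v)%:num * Normc.normc (f v))%:E)).

Definition Linf_pred : {pred T -> R[i]} := fun f => `[< (wnorm f < +oo)%E >].

Record Linf := MkLinf { Linf_fun :> T -> R[i] ; _ : Linf_fun \in Linf_pred }.

HB.instance Definition _ := [isSub for Linf_fun].
HB.instance Definition _ := [Choice of Linf by <:].

Let rnorm_ge0 (z : R[i]) : 0 <= Normc.normc z.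
Proof. by case: z => a b; rewrite sqrtr_ge0. Qed.

Let rnormD (y z : R[i]) :
  Normc.normc (y + z) <= Normc.normc y + Normc.normc z.
Proof.
by have := lec_normD y z; case: (y); case: (z) => a b c d /= /andP[].
Qed.

Lemma wnorm_ub f v : (((mu v)%:num * Normc.normc (f v))%:E <= wnorm f)%E.
Proof. by apply: ereal_sup_ubound; exists v. Qed.

Lemma wnorm_le f (M : \bar R) :
  (forall v, (((mu v)%:num * Normc.normc (f v))%:E <= M)%E) ->
  (wnorm f <= M)%E.
Proof. by move=> fM; apply: ge_ereal_sup => _ [v _ <-]. Qed.

Lemma wnormD f g : (wnorm (f + g)%R <= wnorm f + wnorm g)%E.
Proof.
apply: wnorm_le => v; apply: le_trans (leeD (wnorm_ub f v) (wnorm_ub g v)).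
by rewrite -EFinD lee_fin -mulrDr ler_wpM2l // rnormD.
Qed.

Lemma wnormZ_le (a : R[i]) f :
  (wnorm (a *: f)%R <= (Normc.normc a)%:E * wnorm f)%E.
Proof.
apply: wnorm_le => v.
apply: le_trans (lee_wpmul2l _ (wnorm_ub f v)); last by rewrite lee_fin.
by rewrite -EFinM lee_fin [leLHS](_ : _ = Normc.normc a *
  ((mu v)%:num * Normc.normc (f v))) // mulrCA -Normc.normcM.
Qed.

Lemma wnorm0 : (wnorm 0%R <= 0)%E.
Proof. by apply: wnorm_le => v; rewrite Normc.normc0 mulr0. Qed.

Lemma Linf_predP f : reflect (wnorm f < +oo)%E (f \in Linf_pred).
Proof. exact: asboolP. Qed.

Lemma Linf_submod_closed : submod_closed Linf_pred.
Proof.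
split=> [|a f g /Linf_predP foo /Linf_predP goo]; apply/Linf_predP.
  exact: le_lt_trans wnorm0 _.
apply: le_lt_trans (wnormD _ _) _; apply: lte_add_pinfty => //.
apply: le_lt_trans (wnormZ_le _ _) _.
by rewrite lte_mul_pinfty// ?lee_fin.
Qed.

HB.instance Definition _ :=
  GRing.isSubmodClosed.Build _ _ Linf_pred Linf_submod_closed.
HB.instance Definition _ := [SubChoice_isSubLmodule of Linf by <:].

Definition Linf_norm (f : Linf) : R := fine (wnorm f).

Lemma wnorm_ge0 f : (0 <= wnorm f)%E.
Proof.
by apply: le_trans (wnorm_ub f (tree_root T)); rewrite lee_fin mulr_ge0.
Qed.

Lemma Linf_normE (f : Linf) : (Linf_norm f)%:E = wnorm f.
Proof. by rewrite fineK// ge0_fin_numE ?wnorm_ge0//; case: f => f /= /Linf_predP. Qed.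

Lemma Linf_ub (f : Linf) v : (mu v)%:num * Normc.normc (f v) <= Linf_norm f.
Proof. by rewrite -lee_fin Linf_normE wnorm_ub. Qed.

Lemma Linf_norm_ge0 (f : Linf) : 0 <= Linf_norm f.
Proof. by rewrite -lee_fin Linf_normE wnorm_ge0. Qed.

Lemma Linf_norm_le (f : Linf) (M : R) :
  (forall v, (mu v)%:num * Normc.normc (f v) <= M) -> Linf_norm f <= M.
Proof.
by move=> fM; rewrite -lee_fin Linf_normE; apply: wnorm_le => v; rewrite lee_fin.
Qed.

Let ler_Linf_normD (f g : Linf) :
  (Linf_norm (f + g))%:C%C <= (Linf_norm f)%:C%C + (Linf_norm g)%:C%C.
Proof.
rewrite -rmorphD lecR -lee_fin EFinD !Linf_normE; exact: wnormD.
Qed.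

Let Linf_normZ (a : R[i]) (f : Linf) :
  (Linf_norm (a *: f))%:C%C = `|a| * (Linf_norm f)%:C%C.
Proof.
have normZ_le b (g : Linf) :
    Linf_norm (b *: g) <= Normc.normc b * Linf_norm g.
  by rewrite -lee_fin EFinM !Linf_normE; exact: wnormZ_le.
rewrite -[`|a|]/(Normc.normc a)%:C%C -rmorphM; congr (_ %:C)%C.
apply/eqP; rewrite eq_le normZ_le /=.
have [->|a0] := eqVneq a 0.
  by rewrite Normc.normc0 mul0r Linf_norm_ge0.
have na0 : 0 < Normc.normc a.
  by rewrite lt_def rnorm_ge0 andbT; apply: contraNneq a0 => /Normc.eq0_normc ->.
rewrite -ler_pdivlMl// -Normc.normcV.
by rewrite -{1}[f](scalerK a0) normZ_le.
Qed.

Let Linf_norm0_eq0 (f : Linf) : (Linf_norm f)%:C%C = 0 -> f = 0.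
Proof.
move=> /complexI f0; apply: val_inj; apply/funext => v /=.
apply: Normc.eq0_normc; apply/eqP; rewrite eq_le rnorm_ge0 andbT.
by rewrite -(pmulr_rle0 _ [gt0 of (mu v)%:num]) -f0 Linf_ub.
Qed.

HB.instance Definition _ := Lmodule_isNormed.Build R[i] Linf
  ler_Linf_normD Linf_normZ Linf_norm0_eq0.

End weighted_Linf.

(* The norm of a normed module over [R[i]] takes values in [R[i]], where it is
   real. *)
Definition op_norm {R : realType} {V W : normedModType R[i]} (A : V -> W) :
  \bar R := ereal_sup [set (complex.Re `|A f|)%:E | f in [set f | `|f| <= 1]].

Section composition_operator.
Context {R : realType} {T : tree} (mu : T -> {posnum R}) (phi : T -> T).

Definition is_composition_operator (A : Linf mu -> Linf mu) : Prop :=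
  forall f : Linf mu, A f = (f : T -> R[i]) \o phi :> (T -> R[i]).

Definition composition_bounded : Prop :=
  exists2 A : {linear Linf mu -> Linf mu},
    is_composition_operator A & bounded_near A (nbhs (0 : Linf mu)).

Definition sigma : \bar R :=
  ereal_sup (range (fun v => ((mu v)%:num / (mu (phi v))%:num)%:E)).

End composition_operator.

(* Main.v *)
From HB Require Import structures.
Require Import Defs.
From mathcomp Require Import all_boot all_order all_algebra.
From mathcomp Require Import all_classical all_reals all_analysis.
From mathcomp Require Import complex.
Import Order.TTheory GRing.Theory Num.Theory.
Import numFieldNormedType.Exports.
Local Open Scope ring_scope.

(** Everything rests on two facts about the weighted norm.  A term of the norm
    of [f \o phi] factors as
    [mu v * |f (phi v)| = (mu v / mu (phi v)) * (mu (phi v) * |f (phi v)|)],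
    so the norm of [f \o phi] is at most [sigma] times the norm of [f]
    ([wnorm_comp_le]).  Conversely the single function [1 / mu] has all the
    terms of its norm equal to 1, and composing it with [phi] turns these terms
    into exactly the ratios [mu v / mu (phi v)]: the norm of its image is
    [sigma] itself ([wnorm_inv_weight_comp]).  This one unit vector shows both
    that [sigma] is finite as soon as the composition operator maps the space
    into itself, and that the operator norm is at least [sigma]. *)

Section CompositionOperator.
Context {R : realType} {T : tree} (mu : T -> {posnum R}) (phi : T -> T).

Lemma weight_ratio_le_sigma (v : T) :
  (((mu v)%:num / (mu (phi v))%:num)%:E <= sigma mu phi)%E.
Proof. by apply: ereal_sup_ubound; exists v. Qed.

Lemma sigma_ge0 : (0 <= sigma mu phi)%E.
Proof.
by apply: le_trans (weight_ratio_le_sigma (tree_root T)); rewrite lee_fin.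
Qed.

(** A value of [f] at [phi v] is controlled by the weight at [phi v], while the
    norm of [f \o phi] weighs it with [mu v]; trading one weight for the other
    costs the ratio [mu v / mu (phi v)]. *)
Lemma wnorm_comp_le (f : T -> R[i]) :
  (wnorm mu (f \o phi) <= sigma mu phi * wnorm mu f)%E.
Proof.
apply: wnorm_le => v /=.
have normc_ge0 (z : R[i]) : 0 <= Normc.normc z.
  by case: z => a b; rewrite sqrtr_ge0.
rewrite [X in X%:E](_ : _ = (mu v)%:num / (mu (phi v))%:num *
    ((mu (phi v))%:num * Normc.normc (f (phi v)))); last first.
  by rewrite mulrA divfK.
rewrite EFinM lee_pmul ?lee_fin ?mulr_ge0 ?weight_ratio_le_sigma //.
exact: wnorm_ub.
Qed.

Definition inv_weight (v : T) : R[i] := (((mu v)%:num)^-1)%:C%C.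

Lemma normc_inv_weight (v : T) : Normc.normc (inv_weight v) = (mu v)%:num^-1.
Proof. by rewrite /= expr0n addr0 sqrtr_sqr ger0_norm. Qed.

Lemma wnorm_inv_weight_le1 : (wnorm mu inv_weight <= 1)%E.
Proof. by apply: wnorm_le => v; rewrite normc_inv_weight divff. Qed.

Lemma inv_weight_in_Linf : inv_weight \in Linf_pred mu.
Proof.
by apply/Linf_predP; apply: le_lt_trans wnorm_inv_weight_le1 (ltry 1).
Qed.

Definition Linf_inv_weight : Linf mu := MkLinf inv_weight_in_Linf.

(** The weighted modulus of [inv_weight \o phi] at [v] is the ratio
    [mu v / mu (phi v)], so both sides are suprema of the same family. *)
Lemma wnorm_inv_weight_comp : wnorm mu (inv_weight \o phi) = sigma mu phi.
Proof.
rewrite /wnorm /sigma; congr (ereal_sup _); apply: eq_imagel => v _.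
by rewrite -normc_inv_weight.
Qed.

(** Membership of the image in the weighted space is what makes [sigma]
    finite: the right-hand side is the embedding of a real number. *)
Lemma sigma_eq_norm_image (A : Linf mu -> Linf mu) :
  is_composition_operator phi A ->
  sigma mu phi = (Linf_norm (A Linf_inv_weight))%:E.
Proof. by move=> Aphi; rewrite Linf_normE Aphi -wnorm_inv_weight_comp. Qed.

(** The upper bound holds on the whole unit ball; the reciprocal of the weight
    lies in that ball and attains it. *)
Lemma op_norm_composition (A : Linf mu -> Linf mu) :
  is_composition_operator phi A -> op_norm A = sigma mu phi.
Proof.
move=> Aphi; apply/eqP; rewrite eq_le; apply/andP; split.
- apply: ge_ereal_sup => _ [f f_le1 <-].
  (* The norm of [Linf mu] is by definition [Linf_norm] embedded in [R[i]]. *)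
  rewrite -[X in (X%:E <= _)%E]/(Linf_norm (A f)) Linf_normE Aphi.
  apply: le_trans (wnorm_comp_le _) _.
  rewrite -[leRHS]mule1 lee_wpmul2l ?sigma_ge0 // -Linf_normE lee_fin.
  by move: f_le1 => /=; rewrite -[`|f|]/((Linf_norm f)%:C%C) lecR.
- rewrite (sigma_eq_norm_image _ Aphi); apply: ereal_sup_ubound.
  exists Linf_inv_weight => //=.
  rewrite -[`|_|]/((Linf_norm Linf_inv_weight)%:C%C) lecR.
  by rewrite -lee_fin Linf_normE wnorm_inv_weight_le1.
Qed.

Section FiniteSigma.
Context (sigma_fin : sigma mu phi \is a fin_num).

Lemma comp_in_Linf (f : Linf mu) :
  (f : T -> R[i]) \o phi \in Linf_pred mu.
Proof.
apply/Linf_predP; apply: le_lt_trans (wnorm_comp_le _) _.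
by rewrite -Linf_normE -(fineK sigma_fin) -EFinM ltry.
Qed.

Definition comp_op (f : Linf mu) : Linf mu := MkLinf (comp_in_Linf f).

Lemma comp_op_is_linear : linear comp_op.
Proof. by move=> a f g; apply: val_inj. Qed.

HB.instance Definition _ :=
  GRing.isLinear.Build R[i] (Linf mu) (Linf mu) _ comp_op comp_op_is_linear.

Lemma comp_op_bounded : bounded_near comp_op (nbhs (0 : Linf mu)).
Proof.
apply/linear_boundedP.
exists (fine (sigma mu phi))%:C%C; split.
  by apply: ger0_real; rewrite lecR fine_ge0 // sigma_ge0.
move=> M ltM f; apply: le_trans (ler_wpM2r _ (ltW ltM)) => //.
rewrite -[`|f|]/((Linf_norm f)%:C%C).
rewrite -[`|_|]/((Linf_norm (comp_op f))%:C%C) -rmorphM lecR.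
by rewrite -lee_fin EFinM !Linf_normE (fineK sigma_fin) wnorm_comp_le.
Qed.

End FiniteSigma.
End CompositionOperator.

Theorem theorem3p1 (R : realType) (T : tree) (mu : T -> {posnum R})
    (phi : T -> T) :
  (composition_bounded mu phi <-> sigma mu phi \is a fin_num) /\
  (forall A : {linear Linf mu -> Linf mu},
     is_composition_operator phi A ->
     bounded_near A (nbhs (0 : Linf mu)) ->
     op_norm A = sigma mu phi).
Proof.
split; last by move=> A Aphi _; exact: op_norm_composition.
split=> [[A Aphi _]|sigma_fin].
  by rewrite (sigma_eq_norm_image mu phi A Aphi).
by exists (comp_op mu phi sigma_fin) => //; exact: comp_op_bounded.
Qed.
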